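(* Let $k$ be a field of characteristic $3$ and let $\mathfrak{sl}(2,k)=kx\oplus ky\oplus kz$ be the simple Lie algebra with brackets $[x,y]=z$, $[z,x]=2x$, $[z,y]=-2y$, regarded as a restricted Lie algebra with $p$-map ($p=3$) $$(\lambda x+\mu y+\kappa z)^{[p]}=(\lambda\kappa^2+\lambda^2\mu)x+(\lambda\mu^2+\mu\kappa^2)y+(\kappa^3+\lambda\kappa\mu)z .$$ Then this restricted Lie algebra structure is induced by a restricted pre-Lie algebra structure: with the bilinear product given by $$\{x,x\}=0,\ \{x,y\}=-2z,\ \{x,z\}=x,\quad \{y,x\}=0,\ \{y,y\}=0,\ \{y,z\}=y,\quad \{z,x\}=0,\ \{z,y\}=2y,\ \{z,z\}=z$$ and the $p$-map $(\lambda x+\mu y+\kappa z)^{[p]}=(\lambda\kappa^2+\lambda^2\mu)x+(\lambda\mu^2+\mu\kappa^2)y+(\kappa^3+\lambda\kappa\mu)z$, $(\mathfrak{sl}(2,k),\{-,-\},(-)^{[p]})$ is a restricted pre-Lie algebra whose induced bracket $\{a,b\}-\{b,a\}$ is the bracket $[a,b]$ of $\mathfrak{sl}(2,k)$.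
   Context: A (left) pre-Lie algebra is a $k$-vector space $P$ with a bilinear operation $\{-,-\}:P\times P\to P$ such that $\{x,\{y,z\}\}-\{\{x,y\},z\}=\{y,\{x,z\}\}-\{\{y,x\},z\}$ for all $x,y,z\in P$. Then $[x,y]:=\{x,y\}-\{y,x\}$ is a Lie bracket on $P$. A restricted pre-Lie algebra over a field $k$ of characteristic $p\neq 0$ is a pre-Lie algebra $(P,\{-,-\})$ over $k$ together with a map $(-)^{[p]}:P\to P$ (the $p$-map) such that for all $x,y\in P$, $\alpha\in k$: (1) $(\alpha x)^{[p]}=\alpha^p x^{[p]}$; (2) $\{x^{[p]},y\}=\{x,\{x,\cdots\{x,y\}\cdots\}\}$ ($p$ copies of $x$); (3) $\{y,x^{[p]}\}=\{x,\{x,\cdots\{x,y\}\cdots\}\}-[x,[x,\cdots[x,y]\cdots]]$ ($p$ copies of $x$ in each term); (4) $(x+y)^{[p]}=x^{[p]}+y^{[p]}+\sum_{i=1}^{p-1}s_i(x,y)$, where $i\,s_i(x,y)$ is the coefficient of $\lambda^{i-1}$ in $[\lambda x+y,[\cdots,[\lambda x+y,x]\cdots]]$ with $p-1$ copies of $\lambda x+y$ ($\lambda$ a formal variable). *)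

(* Defs.v *)
From HB Require Import structures.
From mathcomp Require Import all_boot all_order all_algebra.

Set Implicit Arguments.
Unset Strict Implicit.
Unset Printing Implicit Defensive.

Import GRing.Theory.
Local Open Scope ring_scope.

Section Structures.
Variables (k : fieldType) (P : lmodType k).
Implicit Types (br pr : P -> P -> P) (pmap : P -> P).

Record is_lie br : Prop := IsLie {
  lie_linearl : forall y, linear (br ^~ y);
  lie_linearr : forall x, linear (br x);
  lie_alternating : forall x, br x x = 0;
  lie_jacobi : forall x y z,
    br x (br y z) + br y (br z x) + br z (br x y) = 0 }.

Record is_pre_lie pr : Prop := IsPreLie {
  pre_lie_linearl : forall y, linear (pr ^~ y);
  pre_lie_linearr : forall x, linear (pr x);
  pre_lie_left_symmetric : forall x y z,
    pr x (pr y z) - pr (pr x y) z = pr y (pr x z) - pr (pr y x) z }.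

Definition induced_bracket pr (x y : P) : P := pr x y - pr y x.

(* An element of P[lambda], lambda a formal variable, is encoded by its       *)
(* sequence of coefficients f : nat -> P.                                     *)
Definition const_seq (x : P) (n : nat) : P := if n is 0 then x else 0.

(* lambda x + y *)
Definition pencil (x y : P) (n : nat) : P :=
  match n with 0 => y | 1 => x | _ => 0 end.

(* the k[lambda]-bilinear extension of br to P[lambda] *)
Definition seq_bracket br (f g : nat -> P) (n : nat) : P :=
  \sum_(j < n.+1) br (f j) (g (n - j)%N).

(* i * s_i(x, y) is the coefficient of lambda^(i-1) in                        *)
(* [lambda x + y, [.., [lambda x + y, x]..]], with p - 1 nested brackets.     *)
(* It is only used for 0 < i < p with p the characteristic of k, in which     *)
(* case i is invertible in k.                                                 *)
Definition jacobson_s (p : nat) br (i : nat) (x y : P) : P :=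
  i%:R^-1 *: iter p.-1 (seq_bracket br (pencil x y)) (const_seq x) i.-1.

Record is_restricted_lie (p : nat) br pmap : Prop := IsRestrictedLie {
  rlie_char : p \in [pchar k];
  rlie_lie : is_lie br;
  rlie_pmapZ : forall (a : k) x, pmap (a *: x) = a ^+ p *: pmap x;
  rlie_ad_pmap : forall x y, br (pmap x) y = iter p (br x) y;
  rlie_pmapD : forall x y,
    pmap (x + y) = pmap x + pmap y + \sum_(1 <= i < p) jacobson_s p br i x y }.

Record is_restricted_pre_lie (p : nat) pr pmap : Prop := IsRestrictedPreLie {
  rpre_lie_char : p \in [pchar k];
  rpre_lie_pre_lie : is_pre_lie pr;
  rpre_lie_pmapZ : forall (a : k) x, pmap (a *: x) = a ^+ p *: pmap x;
  rpre_lie_mul_pmapl : forall x y, pr (pmap x) y = iter p (pr x) y;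
  rpre_lie_mul_pmapr : forall x y,
    pr y (pmap x) = iter p (pr x) y - iter p (induced_bracket pr x) y;
  rpre_lie_pmapD : forall x y,
    pmap (x + y) = pmap x + pmap y
      + \sum_(1 <= i < p) jacobson_s p (induced_bracket pr) i x y }.

End Structures.

Section SL2.
Variable k : fieldType.

Definition traceless : pred 'M[k]_2 := fun A => \tr A == 0.

Fact traceless_submod_closed : submod_closed traceless.
Proof.
split=> [|a A B]; rewrite !unfold_in ?mxtrace0 // => /eqP trA /eqP trB.
by rewrite mxtraceD mxtraceZ trA trB mulr0 addr0.
Qed.

HB.instance Definition _ :=
  GRing.isSubmodClosed.Build k 'M[k]_2 traceless traceless_submod_closed.

Record sl2 := SL2 { sl2_val :> 'M[k]_2; sl2_traceless : traceless sl2_val }.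

HB.instance Definition _ := [isSub for sl2_val].
HB.instance Definition _ := [Choice of sl2 by <:].
HB.instance Definition _ := [SubChoice_isSubLmodule of sl2 by <:].

Fact sl2_bracket_traceless (A B : sl2) : traceless (A *m B - B *m A).
Proof. by rewrite /traceless raddfB /= mxtrace_mulC subrr. Qed.

Definition sl2_bracket (A B : sl2) : sl2 := SL2 (sl2_bracket_traceless A B).

Fact sl2_x_traceless : traceless (delta_mx 0 1).
Proof. by rewrite /traceless /mxtrace !big_ord_recl big_ord0 !mxE !addr0. Qed.

Fact sl2_y_traceless : traceless (delta_mx 1 0).
Proof. by rewrite /traceless /mxtrace !big_ord_recl big_ord0 !mxE !addr0. Qed.

Fact sl2_z_traceless : traceless (delta_mx 0 0 - delta_mx 1 1).
Proof.
by rewrite /traceless raddfB /= /mxtrace !big_ord_recl !big_ord0 !mxE /= addr0 add0r addr0 subrr.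
Qed.

Definition sl2_x : sl2 := SL2 sl2_x_traceless.
Definition sl2_y : sl2 := SL2 sl2_y_traceless.
Definition sl2_z : sl2 := SL2 sl2_z_traceless.

End SL2.

(* Main.v *)
Require Import Defs.
From HB Require Import structures.
From mathcomp Require Import all_boot all_order all_algebra.
From mathcomp Require Import ring.
Set Implicit Arguments.
Unset Strict Implicit.
Unset Printing Implicit Defensive.
Import GRing.Theory.
Local Open Scope ring_scope.

(** Write q for the quadratic form - det on sl(2). A traceless 2 x 2 matrix a
    satisfies a ^ 2 = q(a) by Cayley-Hamilton, so the p-map of the statement,
    which is the cube of matrices, is a |-> q(a) a. Polarizing, ab + ba = B(a, b)
    with B(a, b) = q(a + b) - q(a) - q(b), and these two relations give over any
    field
      [b, [b, a]] = 4 q(b) a - 2 B(a, b) b.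
    In characteristic 3 both 4 and - 2 are equal to 1. Hence (ad a)^3 = q(a) ad a
    ([sl2_ad3]), and the two Jacobson terms [b, [b, a]] and 2^-1 [a, [b, a]] add
    up to the difference between q(a + b) (a + b) and q(a) a + q(b) b; so sl(2)
    is restricted ([sl2_restricted_lie]).

    In characteristic 3 the pre-Lie product {a, b} is the traceless matrix with
    the same first column as the matrix product ab, and with upper right entry
    a_01 b_00. So left multiplication by a is the action of a on first columns,
    completed by an entry that depends on b only through its first column. The relation
    a ^ 2 = q(a) then gives {a, {a, {a, b}}} = q(a) {a, b} ([sl2_prod3]). The
    commutator of the product is the commutator of matrices in characteristic 3
    ([sl2_prod_bracket]), which also yields left symmetry ([sl2_pre_lie]). The
    remaining axioms of a restricted pre-Lie algebra follow from those of the
    restricted Lie algebra ([restricted_pre_lie_of_lie]). *)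

(** * Restricted structures in general *)

Section Restricted.
Variables (k : fieldType) (P : lmodType k).
Implicit Types (br pr : P -> P -> P) (pmap : P -> P).

Lemma eq_jacobson_s p br br' : br =2 br' ->
  forall i x y, jacobson_s p br i x y = jacobson_s p br' i x y.
Proof.
move=> eq_br i x y; rewrite /jacobson_s; congr (_ *: _).
elim: p.-1 i.-1 => //= m IHm n.
by apply: eq_bigr => j _; rewrite IHm eq_br.
Qed.

(** The two terms are the coefficients of 1 and lambda in
    [lambda x + y, [lambda x + y, x]] = [lambda x + y, [y, x]]. *)
Lemma jacobson_sum3 br x y : br x x = 0 -> br y 0 = 0 ->
  \sum_(1 <= i < 3) jacobson_s 3 br i x y
    = br y (br y x) + 2^-1 *: br x (br y x).
Proof.
move=> brxx bry0; rewrite big_nat_recl // big_nat1 /jacobson_s invr1 scale1r /=.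
by rewrite /seq_bracket !big_ord_recl !big_ord0 /= !addr0 bry0 brxx add0r bry0 add0r.
Qed.

(** Subtracting [pmap x, y] = (ad x)^p y from the axiom on left multiplication by
    pmap x gives the axiom on right multiplication; the other axioms on the p-map
    only involve the bracket. *)
Lemma restricted_pre_lie_of_lie p br pr pmap :
    is_restricted_lie p br pmap -> is_pre_lie pr -> induced_bracket pr =2 br ->
    (forall x y, pr (pmap x) y = iter p (pr x) y) ->
  is_restricted_pre_lie p pr pmap.
Proof.
move=> [pcharp _ pmapZ ad_pmap pmapD] prelie eq_br mul_pmapl; split=> //.
- move=> x y; rewrite -mul_pmapl (eq_iter (eq_br x)) -ad_pmap -eq_br.
  by rewrite /induced_bracket opprB addrC subrK.
- move=> x y; rewrite pmapD; congr (_ + _).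
  by apply: eq_bigr => i _; apply: eq_jacobson_s => ? ?; rewrite eq_br.
Qed.

End Restricted.

(** * Coordinates on sl(2) *)

Section Coordinates.
Variable k : fieldType.
Implicit Types a b : sl2 k.

Definition cx a : k := sl2_val a 0 1.
Definition cy a : k := sl2_val a 1 0.
Definition cz a : k := sl2_val a 0 0.

Lemma sl2_val11 a : sl2_val a 1 1 = - cz a.
Proof.
have := sl2_traceless a; rewrite /traceless.
rewrite /mxtrace !big_ord_recl big_ord0 addr0 addrC addr_eq0 => /eqP tr0.
by rewrite /cz -tr0; congr (sl2_val a _ _); apply/val_inj.
Qed.

Lemma sl2_ext a b : cx a = cx b -> cy a = cy b -> cz a = cz b -> a = b.
Proof.
move=> eqx eqy eqz; apply/val_inj/matrixP => i j.
have ord2 (h : 'I_2) : h = 0 \/ h = 1.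
  by case: h => [[|[|//]] lth]; [left | right]; apply/val_inj.
by case: (ord2 i) => ->; case: (ord2 j) => -> //=; rewrite !sl2_val11 eqz.
Qed.

Lemma coord0 : (cx 0 = 0) * (cy 0 = 0) * (cz 0 = 0).
Proof. by rewrite /cx /cy /cz !mxE. Qed.

Lemma coordD a b :
  (cx (a + b) = cx a + cx b) * (cy (a + b) = cy a + cy b)
  * (cz (a + b) = cz a + cz b).
Proof. by rewrite /cx /cy /cz !mxE. Qed.

Lemma coordN a : (cx (- a) = - cx a) * (cy (- a) = - cy a) * (cz (- a) = - cz a).
Proof. by rewrite /cx /cy /cz !mxE. Qed.

Lemma coordZ (t : k) a :
  (cx (t *: a) = t * cx a) * (cy (t *: a) = t * cy a) * (cz (t *: a) = t * cz a).
Proof. by rewrite /cx /cy /cz !mxE. Qed.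

Lemma coord_x : (cx (sl2_x k) = 1) * (cy (sl2_x k) = 0) * (cz (sl2_x k) = 0).
Proof. by rewrite /cx /cy /cz !mxE. Qed.

Lemma coord_y : (cx (sl2_y k) = 0) * (cy (sl2_y k) = 1) * (cz (sl2_y k) = 0).
Proof. by rewrite /cx /cy /cz !mxE. Qed.

Lemma coord_z : (cx (sl2_z k) = 0) * (cy (sl2_z k) = 0) * (cz (sl2_z k) = 1).
Proof. by rewrite /cx /cy /cz !mxE !subr0. Qed.

Lemma mulmx2E (A B : 'M[k]_2) i j : (A *m B) i j = A i 0 * B 0 j + A i 1 * B 1 j.
Proof.
rewrite !mxE !big_ord_recl big_ord0 addr0.
by congr (_ + A _ _ * B _ _); apply/val_inj.
Qed.

Lemma coord_bracket a b :
  (cx (sl2_bracket a b) = 2 * (cz a * cx b - cx a * cz b))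
  * (cy (sl2_bracket a b) = 2 * (cy a * cz b - cz a * cy b))
  * (cz (sl2_bracket a b) = cx a * cy b - cy a * cx b).
Proof.
have subE (A B : 'M[k]_2) i j : (A - B) i j = A i j - B i j by rewrite !mxE.
rewrite /cx /cy /cz /= !subE !mulmx2E !sl2_val11 -/(cx _) -/(cy _) -/(cz _).
rewrite -/(cx b) -/(cy b) -/(cz b).
by split; [split|]; ring.
Qed.

Definition coordE :=
  (coord0, coordD, coordN, coordZ, coord_x, coord_y, coord_z, coord_bracket).

Lemma sl2_coordK a : cx a *: sl2_x k + cy a *: sl2_y k + cz a *: sl2_z k = a.
Proof. by apply: sl2_ext; rewrite !coordE; ring. Qed.

End Coordinates.

(** * The restricted Lie algebra sl(2) *)

Section Lie.
Variable k : fieldType.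
Implicit Types a b : sl2 k.

(** This is - det. *)
Definition quad a : k := cz a ^+ 2 + cx a * cy a.

(** By Cayley-Hamilton this is the cube of the matrix a. *)
Definition sl2_pmap a : sl2 k := quad a *: a.

Lemma sl2_pmapE (l m c : k) :
  sl2_pmap (l *: sl2_x k + m *: sl2_y k + c *: sl2_z k)
    = (l * c ^+ 2 + l ^+ 2 * m) *: sl2_x k + (l * m ^+ 2 + m * c ^+ 2) *: sl2_y k
      + (c ^+ 3 + l * c * m) *: sl2_z k.
Proof. by apply: sl2_ext; rewrite /sl2_pmap /quad !coordE; ring. Qed.

Lemma quadZ (t : k) a : quad (t *: a) = t ^+ 2 * quad a.
Proof. by rewrite /quad !coordE; ring. Qed.

Lemma sl2_is_lie : is_lie (@sl2_bracket k).
Proof.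
split.
- by move=> b t a a'; apply: sl2_ext; rewrite !coordE; ring.
- by move=> a t b b'; apply: sl2_ext; rewrite !coordE; ring.
- by move=> a; apply: sl2_ext; rewrite !coordE; ring.
- by move=> a b c; apply: sl2_ext; rewrite !coordE; ring.
Qed.

(** Both a ^ 2 = q(a) and its polarization ab + ba = B(a, b) are scalars, so they
    reduce [b, [b, a]] = bba - 2 bab + abb to this combination of a and b. *)
Lemma sl2_double_bracket a b :
  sl2_bracket b (sl2_bracket b a)
    = (4 * quad b) *: a - (2 * (quad (a + b) - quad a - quad b)) *: b.
Proof. by apply: sl2_ext; rewrite /quad !coordE; ring. Qed.

Lemma sl2_double_bracketr a b :
  sl2_bracket a (sl2_bracket b a)
    = (2 * (quad (a + b) - quad a - quad b)) *: a - (4 * quad a) *: b.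
Proof. by apply: sl2_ext; rewrite /quad !coordE; ring. Qed.

Hypothesis char_k : 3%N \in [pchar k].

Lemma three_eq0 : 3 = 0 :> k.
Proof. exact: pcharf0 char_k. Qed.

Lemma two_eqN1 : 2 = - 1 :> k.
Proof. by apply/eqP; rewrite -addr_eq0 -three_eq0; apply/eqP; ring. Qed.

Lemma four_eq1 : 4 = 1 :> k.
Proof. by rewrite -[RHS]addr0 -three_eq0; ring. Qed.

(** Over any field (ad a)^3 = 4 q(a) ad a: apply [sl2_double_bracketr] to b and
    then bracket with a, which kills the multiple of a. *)
Lemma sl2_ad3 a b : sl2_bracket (sl2_pmap a) b = iter 3 (sl2_bracket a) b.
Proof.
suff -> : iter 3 (sl2_bracket a) b = (4 * quad a) *: sl2_bracket a b.
  by rewrite four_eq1 mul1r; apply: sl2_ext; rewrite /sl2_pmap !coordE; ring.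
by apply: sl2_ext; rewrite /= /quad !coordE; ring.
Qed.

Lemma sl2_restricted_lie : is_restricted_lie 3 (@sl2_bracket k) sl2_pmap.
Proof.
split=> //; first exact: sl2_is_lie.
- by move=> t a; rewrite /sl2_pmap quadZ !scalerA; congr (_ *: _); ring.
- exact: sl2_ad3.
move=> a b; rewrite jacobson_sum3; last 2 first.
- exact: lie_alternating sl2_is_lie a.
- by apply: sl2_ext; rewrite !coordE; ring.
(* The values of q at a, b and a + b stay unexpanded: both sides are then equal as
   linear combinations of a and b. *)
rewrite sl2_double_bracket sl2_double_bracketr four_eq1 two_eqN1 invrN invr1.
by apply: sl2_ext; rewrite /sl2_pmap !(coordD, coordN, coordZ); ring.
Qed.

(** * The pre-Lie product *)

(** The first column of this matrix is the first column of the matrix product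
    a b. *)
Definition sl2_prod a b : sl2 k :=
  (cx a * cz b) *: sl2_x k + (cy a * cz b - cz a * cy b) *: sl2_y k
  + (cz a * cz b + cx a * cy b) *: sl2_z k.

(** Two multiplications by a scale the first column by a ^ 2 = q(a). So the first
    column of {a, {a, {a, b}}} is q(a) times that of ab, and its upper right entry
    is a_01 (q(a) b_00). *)
Lemma sl2_prod3 a b : sl2_prod (sl2_pmap a) b = iter 3 (sl2_prod a) b.
Proof. by apply: sl2_ext; rewrite /= /sl2_prod /sl2_pmap /quad !coordE; ring. Qed.

(** The first columns agree in every characteristic. The upper right entry
    is a_01 b_00 - b_01 a_00 for the induced bracket and - 2 times this for
    ab - ba, and - 2 = 1. *)
Lemma sl2_prod_bracket : induced_bracket sl2_prod =2 @sl2_bracket k.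
Proof.
move=> a b; apply: sl2_ext; rewrite /induced_bracket /sl2_prod !coordE;
  [rewrite two_eqN1 | |]; ring.
Qed.

(** On first columns the product is the action of matrices, so the difference is
    (ab - ba) c. In the upper right entry the terms a_01 b_01 c_10 cancel and there
    remains (a_01 b_00 - b_01 a_00) c_00, in which the first factor is the upper
    right entry of ab - ba because 2 = - 1. *)
Lemma sl2_prod_rep a b c :
  sl2_prod a (sl2_prod b c) - sl2_prod b (sl2_prod a c)
    = sl2_prod (sl2_bracket a b) c.
Proof.
apply: sl2_ext; rewrite /sl2_prod !coordE; [rewrite two_eqN1 | |]; ring.
Qed.

(** Left symmetry says that left multiplication represents the induced bracket. *)
Lemma sl2_pre_lie : is_pre_lie sl2_prod.
Proof.
have linl b : linear (sl2_prod ^~ b).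
  by move=> t a a'; apply: sl2_ext; rewrite /sl2_prod !coordE; ring.
split=> // [a t b b'|a b c].
  by apply: sl2_ext; rewrite /sl2_prod !coordE; ring.
have subl u v : sl2_prod (u - v) c = sl2_prod u c - sl2_prod v c.
  by rewrite addrC -scaleN1r linl scaleN1r addrC.
have /eqP := sl2_prod_rep a b c.
rewrite -sl2_prod_bracket subl subr_eq => /eqP ->.
by rewrite addrC -addrA addKr addrC.
Qed.

End Lie.

(** * The restricted pre-Lie structure on sl(2) *)

Theorem mainTheorem6 (k : fieldType) (char_k : 3%N \in [pchar k]) :
  let x := sl2_x k in let y := sl2_y k in let z := sl2_z k in
  (* sl(2,k) = kx + ky + kz is a direct sum, with the given brackets *)
  [/\ forall a : sl2 k,
        exists! c : k * k * k, a = c.1.1 *: x + c.1.2 *: y + c.2 *: z,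
      sl2_bracket x y = z,
      sl2_bracket z x = 2 *: x &
      sl2_bracket z y = (- 2) *: y] /\
  (* the p-map and the restricted Lie algebra structure it defines *)
  exists pmap : sl2 k -> sl2 k,
  [/\ forall l m c : k,
        pmap (l *: x + m *: y + c *: z) =
          (l * c ^+ 2 + l ^+ 2 * m) *: x + (l * m ^+ 2 + m * c ^+ 2) *: y
          + (c ^+ 3 + l * c * m) *: z,
      is_restricted_lie 3 (@sl2_bracket k) pmap &
      (* the restricted pre-Lie algebra structure inducing it *)
      exists pr : sl2 k -> sl2 k -> sl2 k,
      [/\ [/\ pr x x = 0, pr x y = (- 2) *: z & pr x z = x],
          [/\ pr y x = 0, pr y y = 0 & pr y z = y],
          [/\ pr z x = 0, pr z y = 2 *: y & pr z z = z],
          is_restricted_pre_lie 3 pr pmap &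
          forall a b : sl2 k, pr a b - pr b a = sl2_bracket a b]].
Proof.
move=> x y z; split.
  split; [| by apply: sl2_ext; rewrite !coordE; ring ..].
  move=> a; exists (cx a, cy a, cz a); split=> [|[[l m] c] /= ->].
    by rewrite sl2_coordK.
  by congr (_, _, _); rewrite !coordE; ring.
exists (@sl2_pmap k); split.
- exact: sl2_pmapE.
- exact: sl2_restricted_lie.
exists (@sl2_prod k); split; last exact: sl2_prod_bracket.
- by split; apply: sl2_ext; rewrite /sl2_prod !coordE ?two_eqN1 //; ring.
- by split; apply: sl2_ext; rewrite /sl2_prod !coordE; ring.
- by split; apply: sl2_ext; rewrite /sl2_prod !coordE ?two_eqN1 //; ring.
apply: restricted_pre_lie_of_lie.
- exact: sl2_restricted_lie.
- exact: sl2_pre_lie.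
- exact: sl2_prod_bracket.
- exact: sl2_prod3.
Qed.
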